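(* Let $p,q$ be complex constants and let $(a_n^k)_{n,k\ge0}$ be complex numbers satisfying $$a_n^k=p\,a_n^{k-1}+q\,(n+1)\,a_{n+1}^{k-1}\qquad(n\ge0,\ k\ge1).$$ Then, as formal power series, $$\bar A(t)=\exp(pt)\;a(qt).$$
   Context: Superscripts in $a_n^k$ are indices, not powers. The initial sequence $(a_n^0)_{n\ge0}$ is arbitrary. $a(t)=\sum_{n\ge0}a_n^0t^n$ is the ordinary generating function of the initial sequence and $\bar A(t)=\sum_{n\ge0}a_0^n\frac{t^n}{n!}$ is the exponential generating function of the final sequence $(a_0^n)_{n\ge0}$. *)

(* Defs.v *)
From mathcomp Require Import all_boot all_algebra.
From mathcomp Require Import reals.
From mathcomp Require Import complex.

Set Implicit Arguments.
Unset Strict Implicit.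
Unset Printing Implicit Defensive.

Import GRing.Theory.
Local Open Scope ring_scope.

(* A formal power series \sum_n (f n) t^n is represented by its coefficient
   sequence f; equality of series is equality of coefficient sequences. *)
Definition fps (F : fieldType) : Type := nat -> F.

Definition fps_mul (F : fieldType) (f g : fps F) : fps F :=
  fun n => \sum_(i < n.+1) f i * g (n - i)%N.

(* The substitution t := c t, i.e. the series f(c t) = \sum_n (f n) (c t)^n. *)
Definition fps_scale (F : fieldType) (c : F) (f : fps F) : fps F :=
  fun n => f n * c ^+ n.

Definition fps_exp (F : fieldType) : fps F := fun n => (n`!%:R)^-1.

Definition ogf (F : fieldType) (u : nat -> F) : fps F := fun n => u n.

Definition egf (F : fieldType) (u : nat -> F) : fps F := fun n => u n / n`!%:R.

Arguments fps_exp : clear implicits.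

(* Main.v *)
(** Put [b n k = n! * a n k].  The factor [n+1] of the recurrence is absorbed
    and [b n k.+1 = p * b n k + q * b n.+1 k], i.e. [b n k] is the value at [n]
    of [(p + q S)^k] applied to [b _ 0], where [S] is the shift in the lower
    index.  The binomial theorem for [(p + q S)^k] at [n = 0], divided by [k!],
    is the coefficient of [t^k] in the asserted product of series. *)
Require Import Defs.
From mathcomp Require Import all_boot all_algebra.
From mathcomp Require Import boolp reals.
From mathcomp Require Import complex.
From mathcomp Require Import ring.

Import GRing.Theory Num.Theory.
Local Open Scope ring_scope.

Lemma binomial_shift_recurrence (K : comNzRingType) (p q : K)
    (b : nat -> nat -> K)
    (hb : forall n k, b n k.+1 = p * b n k + q * b n.+1 k) (n k : nat) :
  b n k = \sum_(i < k.+1) p ^+ (k - i) * q ^+ i * b (n + i)%N 0%N *+ 'C(k, i).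
Proof.
elim: k n => [|k IHk] n.
  by rewrite big_ord1 !expr0 !mul1r bin0 addn0.
rewrite hb !IHk [RHS]big_ord_recl /=.
under [X in _ = _ + X]eq_bigr => i _ do
  rewrite /bump add1n subSS binS mulrnDr.
(* Pascal's rule has split each term: those with ['C(k, i.+1)], joined to the head, give [p * b n k]
   (the top one vanishes); those with ['C(k, i)] give [q * b n.+1 k]. *)
rewrite big_split /= addrA; congr (_ + _).
  rewrite [X in _ = _ + X]big_ord_recr /= (bin_small (ltnSn k)) mulr0n addr0.
  rewrite big_ord_recl mulrDr mulr_sumr; congr (_ + _).
    by rewrite !bin0 !subn0 !mulr1n !mulrA -exprS.
  apply: eq_bigr => i _; rewrite /= /bump add1n.
  by rewrite mulrnAr !mulrA -exprS subnSK.
rewrite mulr_sumr; apply: eq_bigr => i _.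
by rewrite mulrnAr addSnnS exprS; congr (_ *+ _); ring.
Qed.

Lemma bin_div_fact (F : numFieldType) (n i : nat) : (i <= n)%N ->
  'C(n, i)%:R / n`!%:R = (i`!%:R)^-1 * ((n - i)`!%:R)^-1 :> F.
Proof.
move=> le_in; have fact_neq0 m : m`!%:R != 0 :> F.
  by rewrite pnatr_eq0 -lt0n fact_gt0.
rewrite -(bin_fact le_in) !natrM; field.
by rewrite !fact_neq0 pnatr_eq0 -lt0n bin_gt0.
Qed.

(* [a n k] is the entry with lower index n and upper index k. *)
Theorem theorem20 (R : realType) (p q : R[i]) (a : nat -> nat -> R[i])
    (ha : forall n k : nat,
      a n k.+1 = p * a n k + q * n.+1%:R * a n.+1 k) :
  egf (fun n => a 0%N n) =
  fps_mul (fps_scale p (fps_exp R[i])) (fps_scale q (ogf (fun n => a n 0%N))).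
Proof.
apply: funext => k; rewrite /egf /fps_mul /fps_scale /fps_exp /ogf.
pose b n m := n`!%:R * a n m.
have hb n m : b n m.+1 = p * b n m + q * b n.+1 m.
  by rewrite /b ha factS natrM; ring.
have -> : a 0%N k = b 0%N k by rewrite /b fact0 mul1r.
rewrite (binomial_shift_recurrence _ p q b hb) mulr_suml.
(* The reversal [i -> k - i] gives [p] the exponent [i], as in the Cauchy product. Then [1/i!] is
   the exponential coefficient, and [1/(k - i)!] cancels the factorial in [b]. *)
rewrite (reindex_inj rev_ord_inj) /=; apply: eq_bigr => i _.
have le_ik : (i <= k)%N by rewrite -ltnS.
rewrite subSS subKn // bin_sub // add0n /b -mulr_natr -[LHS]mulrA bin_div_fact //.
field.
by rewrite !pnatr_eq0 -!lt0n !fact_gt0.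
Qed.
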